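(* Let $\Omega\subset\mathbb R^d$ be convex and compact and let $\mu_1\in\mathcal M(\Omega)$. Then the curve $\mu^{\mathrm H}(s):=s^2\mu_1$, $s\in[0,1]$, is the unique geodesic curve in $(\mathcal M(\Omega),\mathsf{HK})$ connecting the null measure $\mu_0=0$ to $\mu_1$.
   Context: $\mathcal M(\Omega)$ is the set of finite nonnegative Borel measures on $\Omega$. The cone over $\Omega$ is $\mathfrak C_\Omega:=(\Omega\times[0,\infty[)/(\Omega\times\{0\})$, with points $[x,r]$, and metric $\mathsf d_{\mathfrak C}([x_0,r_0],[x_1,r_1])^2=r_0^2+r_1^2-2r_0r_1\cos_\pi(|x_0-x_1|)$, $\cos_\pi(L)=\cos(\min\{L,\pi\})$. $\mathcal M_2(\mathfrak C_\Omega)$ is the set of finite nonnegative Borel measures with $\int r^2\mathrm d\lambda<\infty$. $\mathsf W_{\mathfrak C}(\lambda_0,\lambda_1)^2=\inf\iint\mathsf d_{\mathfrak C}^2\,\mathrm d\gamma$ over nonnegative measures $\gamma$ on $\mathfrak C_\Omega\times\mathfrak C_\Omega$ with marginals $\lambda_0,\lambda_1$ ($=\infty$ if the masses differ). The projection $\mathfrak P:\mathcal M_2(\mathfrak C_\Omega)\to\mathcal M(\Omega)$ is given by $\int_\Omega\phi\,\mathrm d\mathfrak P\lambda=\int r^2\phi(x)\,\mathrm d\lambda([x,r])$, $\phi\in\mathrm C^0(\Omega)$. The Hellinger–Kantorovich distance is $\mathsf{HK}(\mu_0,\mu_1)=\min\{\mathsf W_{\mathfrak C}(\lambda_0,\lambda_1)\mid\mathfrak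 P\lambda_j=\mu_j\}$. A geodesic curve is a curve with $\mathsf{HK}(\mu(s),\mu(t))=|s-t|\,\mathsf{HK}(\mu(0),\mu(1))$ for all $s,t\in[0,1]$. *)

(* Defs.v *)
From HB Require Import structures.
From mathcomp Require Export all_boot all_order all_algebra.
From mathcomp Require Export all_classical all_reals all_analysis.

Set Implicit Arguments.
Unset Strict Implicit.
Unset Printing Implicit Defensive.

Import Order.TTheory GRing.Theory Num.Theory.
Import numFieldNormedType.Exports.

Local Open Scope classical_set_scope.
Local Open Scope ring_scope.
Local Open Scope quotient_scope.

(* Measures on Omega are encoded as Borel measures on the whole of R^d that
   vanish outside Omega, and measures on the cone over Omega as Borel measures
   on the cone over R^d that vanish outside the cone over Omega. A subtype of
   R^d would have to be inhabited to be a [measurableType]; this encoding also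
   covers the empty set. *)

Definition borel_rV (R : realType) (d : nat) : measurableType _ :=
  g_sigma_algebraType (@open 'rV[R]_d).

Notation finite_borel R d := {finite_measure set (borel_rV R d) -> \bar R}.

Section distance.
Context {R : realType} {d : nat}.

(* The library norm on row vectors is the sup norm. *)
Definition eucl_dist (x y : 'rV[R]_d) : R :=
  Num.sqrt (\sum_(i < d) (x 0 i - y 0 i) ^+ 2).

End distance.

Section cone.
Context (R : realType) (d : nat).

Definition cone_rel (p q : 'rV[R]_d * {nonneg R}) : bool :=
  (p == q) || (p.2%:num == 0) && (q.2%:num == 0).

Lemma cone_rel_refl : reflexive cone_rel.
Proof. by move=> p; rewrite /cone_rel eqxx. Qed.

Lemma cone_rel_sym : symmetric cone_rel.
Proof. by move=> p q; rewrite /cone_rel eq_sym andbC. Qed.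

Lemma cone_rel_trans : transitive cone_rel.
Proof.
move=> q p r; rewrite /cone_rel => /orP[/eqP->//|/andP[p0 q0]].
by move=> /orP[/eqP<-|/andP[_ r0]]; apply/orP; right; apply/andP.
Qed.

Canonical cone_equiv := EquivRel cone_rel cone_rel_refl cone_rel_sym
  cone_rel_trans.

Definition cone : Type := {eq_quot cone_equiv}.


HB.instance Definition _ := Choice.on cone.
HB.instance Definition _ := EqQuotient.on cone.
HB.instance Definition _ := isPointed.Build cone (\pi_cone (0, 0%:nng)).

Definition cone_pt (x : 'rV[R]_d) (r : {nonneg R}) : cone := \pi_cone (x, r).

Definition cone_radius (p : cone) : R := (repr p).2%:num.

(* Unspecified at the apex. *)
Definition cone_base (p : cone) : 'rV[R]_d := (repr p).1.

Definition cos_pi (L : R) : R := cos (Num.min L pi).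

Definition cone_dist (p q : cone) : R :=
  Num.sqrt (cone_radius p ^+ 2 + cone_radius q ^+ 2
    - 2 * cone_radius p * cone_radius q
      * cos_pi (eucl_dist (cone_base p) (cone_base q))).

Lemma repr_cone_pt x r : cone_rel (repr (cone_pt x r)) (x, r).
Proof. by apply/eqmodP; rewrite reprK. Qed.

Lemma cone_radiusE x r : cone_radius (cone_pt x r) = r%:num.
Proof.
rewrite /cone_radius.
by have /orP[/eqP->//|/andP[/eqP-> /eqP/= ->]] := repr_cone_pt x r.
Qed.

Lemma cone_distE x0 r0 x1 r1 :
  cone_dist (cone_pt x0 r0) (cone_pt x1 r1) =
  Num.sqrt (r0%:num ^+ 2 + r1%:num ^+ 2
    - 2 * r0%:num * r1%:num * cos_pi (eucl_dist x0 x1)).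
Proof.
rewrite /cone_dist !cone_radiusE /cone_base.
have /orP[/eqP->|/andP[_ /eqP/= ->]] := repr_cone_pt x0 r0; last first.
  by rewrite !(mulr0, mul0r).
have /orP[/eqP->//|/andP[_ /eqP/= ->]] := repr_cone_pt x1 r1.
by rewrite !(mulr0, mul0r).
Qed.

(* Open sets of the metric [cone_dist]. *)
Definition cone_open : set (set cone) := [set U | forall p, U p ->
  exists2 e : R, 0 < e & forall q, cone_dist p q < e -> U q].

Definition cone_over (Omega : set 'rV[R]_d) : set cone :=
  [set cone_pt x r | x in Omega & r in [set: {nonneg R}]].

End cone.

Arguments cone_over {R d} Omega.

Definition borel_cone (R : realType) (d : nat) : measurableType _ :=
  g_sigma_algebraType (@cone_open R d).

Notation finite_borel_cone R d :=
  {finite_measure set (borel_cone R d) -> \bar R}.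

(* Set functions may differ on non-measurable sets. *)
Definition measure_eq d (T : measurableType d) (R : realType)
  (m1 m2 : set T -> \bar R) : Prop := forall A, measurable A -> m1 A = m2 A.

Section hellinger_kantorovich.
Context {R : realType} {d : nat}.
Local Open Scope ereal_scope.

Definition measures_on (Omega : set 'rV[R]_d) : set (finite_borel R d) :=
  [set mu : finite_borel R d | mu (~` Omega) = 0].

Definition cone_measures2 (Omega : set 'rV[R]_d)
    : set (finite_borel_cone R d) :=
  [set lambda : finite_borel_cone R d | lambda (~` cone_over Omega) = 0
    /\ \int[lambda]_p (cone_radius p ^+ 2)%:E < +oo].

(* The product sigma-algebra is the Borel sigma-algebra of the product of the
   two cones, since these are separable. *)
Definition couplings (lambda0 lambda1 : finite_borel_cone R d)
    : set {measure set (borel_cone R d * borel_cone R d)%type -> \bar R} :=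
  [set gamma : {measure set (borel_cone R d * borel_cone R d)%type -> \bar R}
    | measure_eq (pushforward gamma fst) lambda0
    /\ measure_eq (pushforward gamma snd) lambda1].

Definition W_cone (lambda0 lambda1 : finite_borel_cone R d) : \bar R :=
  sqrte (ereal_inf
    [set \int[gamma]_pq (cone_dist pq.1 pq.2 ^+ 2)%:E
      | gamma in couplings lambda0 lambda1]).

(* Graph of the projection lambda |-> mu: mu is determined by lambda on the
   Borel sets. The base point is irrelevant at the apex, where the radius
   is 0. *)
Definition is_cone_proj (Omega : set 'rV[R]_d) (lambda : finite_borel_cone R d)
    (mu : finite_borel R d) : Prop :=
  forall phi : 'rV[R]_d -> R, {within Omega, continuous phi} ->
    \int[mu]_(x in Omega) (phi x)%:E =
    \int[lambda]_(p in cone_over Omega)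
      (cone_radius p ^+ 2 * phi (cone_base p))%:E.

(* The infimum is attained, so this is the minimum. *)
Definition HK (Omega : set 'rV[R]_d) (mu0 mu1 : finite_borel R d) : \bar R :=
  ereal_inf [set W_cone lambda.1 lambda.2 | lambda in
    [set lambda : finite_borel_cone R d * finite_borel_cone R d |
      [/\ cone_measures2 Omega lambda.1, cone_measures2 Omega lambda.2,
          is_cone_proj Omega lambda.1 mu0 & is_cone_proj Omega lambda.2 mu1]]].

(* Only the values of a curve on [0, 1] matter. *)
Definition geodesic_curve (Omega : set 'rV[R]_d) (mu : R -> finite_borel R d)
    : Prop :=
  (forall s, s \in `[0%R, 1%R] -> measures_on Omega (mu s)) /\
  (forall s t, s \in `[0%R, 1%R] -> t \in `[0%R, 1%R] ->
    HK Omega (mu s) (mu t) = `|s - t|%:E * HK Omega (mu 0%R) (mu 1%R)).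

Definition geodesic_connecting (Omega : set 'rV[R]_d)
    (mu0 mu1 : finite_borel R d) (mu : R -> finite_borel R d) : Prop :=
  [/\ geodesic_curve Omega mu, measure_eq (mu 0%R) mu0
    & measure_eq (mu 1%R) mu1].

Definition null_measure : finite_borel R d := mzero.

Definition hellinger_curve (mu1 : finite_borel R d) (s : R)
    : finite_borel R d :=
  mscale (NngNum (sqr_ge0 s)) mu1.

End hellinger_kantorovich.

(* Main.v *)
From HB Require Import structures.
From mathcomp Require Import measurable_realfun ring lra.
Require Import Defs.

Set Implicit Arguments.
Unset Strict Implicit.
Unset Printing Implicit Defensive.

Import Order.TTheory GRing.Theory Num.Theory.
Import numFieldNormedType.Exports.

Local Open Scope classical_set_scope.
Local Open Scope ring_scope.

(** For [theta > 0] the squared cone distance is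
      [(1 - theta) r0^2 + (1 - 1/theta) r1^2
         + (theta r0 - r1)^2 / theta + 2 r0 r1 (1 - cos_pi |x0 - x1|)].
    Integrating against a coupling of lifts and optimising over [theta] gives
    [HK mu0 mu1 >= |sqrt mass0 - sqrt mass1|]. Pushing [mu] forward under
    [x |-> ([x, s], [x, t])] attains this bound for [s^2 mu] and [t^2 mu], so
    [s |-> s^2 mu1] is a geodesic.

    Conversely, let [mu] be a geodesic from [0] to [mu1] and [0 < s <= 1]. The
    distance to [0] fixes the mass of [mu s], and for [theta = 1/s] almost
    optimal couplings of lifts of [mu s] and [mu1] make the integral of the last
    two (nonnegative) terms arbitrarily small. Together they dominate
    [|r0^2 phi x0 - s^2 r1^2 phi x1|] for Lipschitz [phi], up to an arbitrarily
    small multiple of [r0^2 + s^2 r1^2]; hence [mu s] and [s^2 mu1] have the same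
    integral against every Lipschitz function. Working with almost optimal
    couplings, neither the existence of optimal ones nor the triangle inequality
    of [HK] is needed. *)

(** * Geometry of the cone *)

Section cos_pi_theory.
Context {R : realType}.
Implicit Types L : R.

Lemma cos_pi_le1 L : cos_pi L <= 1.
Proof. exact: cos_le1. Qed.

Lemma cos_pi_nonincreasing L L' : 0 <= L -> L <= L' -> cos_pi L' <= cos_pi L.
Proof.
move=> L0 LL'; rewrite /cos_pi.
set a := Num.min L pi; set b := Num.min L' pi.
have pi0 := pi_ge0 R.
have ab : a <= b by rewrite /a /b le_min !ge_min LL' lexx !orbT.
have a0 : 0 <= a by rewrite /a le_min L0.
have bpi : b <= pi by rewrite /b ge_min lexx orbT.
rewrite leNgt ltr_cos ?in_itv/= ?a0 ?bpi ?(le_trans a0 ab) ?(le_trans ab bpi)//.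
by rewrite -leNgt.
Qed.

Lemma cos_pi_lt1 L : 0 < L -> cos_pi L < 1.
Proof.
move=> L0; rewrite /cos_pi -(@cos0 R).
have pi0 := pi_gt0 R.
rewrite ltr_cos ?in_itv/= ?lexx ?(ltW pi0)//.
- by rewrite lt_min L0.
- by rewrite le_min (ltW L0) (ltW pi0)/= ge_min lexx orbT.
Qed.

Lemma cos_pi0 : cos_pi (0 : R) = 1.
Proof. by rewrite /cos_pi min_l ?cos0// pi_ge0. Qed.

Lemma continuous_cos_pi : continuous (@cos_pi R).
Proof.
move=> x; apply: (@continuous_comp _ _ _ (fun L => Num.min L pi) cos).
  apply: continuous_min; [exact: cvg_id|exact: cvg_cst].
exact: continuous_cos.
Qed.

End cos_pi_theory.

Section eucl_dist_theory.
Context {R : realType} {d : nat}.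
Implicit Types x y : 'rV[R]_d.

Lemma eucl_distxx x : eucl_dist x x = 0.
Proof.
by rewrite /eucl_dist big1 ?sqrtr0// => i _; rewrite subrr expr0n.
Qed.

(** Balls and Lipschitz constants refer to the sup norm, the cone metric to the Euclidean distance;
    this comparison carries Euclidean closeness over to the former. *)
Lemma sup_norm_le_eucl_dist x y : `|x - y| <= eucl_dist x y.
Proof.
rewrite [leLHS]/Num.norm/= mx_normrE; apply: bigmax_le; first exact: sqrtr_ge0.
move=> [i j] _ /=; rewrite ord1 /eucl_dist -sqrtr_sqr; apply: ler_wsqrtr.
rewrite !mxE (bigD1 j)//= lerDl sumr_ge0// => k _; exact: sqr_ge0.
Qed.

Lemma continuous_eucl_dist x : continuous (eucl_dist x).
Proof.
move=> y; rewrite /eucl_dist.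
apply: (@continuous_comp _ _ _
  (fun y : 'rV[R]_d => \sum_(i < d) (x 0 i - y 0 i) ^+ 2) Num.sqrt);
  last exact: sqrt_continuous.
apply: (@cvg_big R _ +%R 0 xpredT _ _ (nbhs y)) => [|i _].
  exact: add_continuous.
rewrite expr2; under eq_fun do rewrite expr2.
by apply: cvgM; (apply: cvgB; [exact: cvg_cst|exact: coord_continuous]).
Qed.

End eucl_dist_theory.

Section cone_metric.
Context {R : realType} {d : nat}.
Implicit Types p q : cone R d.

Lemma cone_radius_ge0 p : 0 <= cone_radius p.
Proof. by rewrite /cone_radius. Qed.

Lemma cone_ptK p : cone_pt (cone_base p) (repr p).2 = p.
Proof. by rewrite /cone_pt /cone_base -surjective_pairing reprK. Qed.

Lemma cone_base_pt (x : 'rV[R]_d) (r : {nonneg R}) :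
  0 < r%:num -> cone_base (cone_pt x r) = x.
Proof.
move=> r0; rewrite /cone_base.
have /orP[/eqP->//|/andP[_ /eqP/= r00]] := repr_cone_pt x r.
by rewrite r00 ltxx in r0.
Qed.

(** Completing the square separates a radial part from an angular part, both nonnegative, so each
    can be bounded on its own by the squared distance. *)
Lemma cone_dist_sqrE p q : cone_dist p q ^+ 2 =
  (cone_radius p - cone_radius q) ^+ 2 +
  2 * cone_radius p * cone_radius q *
    (1 - cos_pi (eucl_dist (cone_base p) (cone_base q))).
Proof.
set c := cos_pi _; rewrite /cone_dist -/c sqr_sqrtr.
  ring.
have p0 := cone_radius_ge0 p; have q0 := cone_radius_ge0 q.
have c1 : c <= 1 by exact: cos_pi_le1.
move: (cone_radius p) (cone_radius q) p0 q0 => a b a0 b0.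
have : 0 <= (a - b) ^+ 2 by exact: sqr_ge0.
have : 0 <= a * b * (1 - c) by rewrite mulr_ge0 ?mulr_ge0 ?subr_ge0.
nra.
Qed.

Lemma dist_radius_le p q :
  `|cone_radius p - cone_radius q| <= cone_dist p q.
Proof.
rewrite -sqrtr_sqr -[leRHS]ger0_norm ?sqrtr_ge0// -[leRHS]sqrtr_sqr.
apply: ler_wsqrtr; rewrite cone_dist_sqrE lerDl.
by rewrite mulr_ge0 ?subr_ge0 ?cos_pi_le1// !mulr_ge0 ?cone_radius_ge0.
Qed.

(* Away from the apex, closeness in the cone forces closeness of the base
   points, because [1 - cos_pi] is bounded below off zero. *)
Lemma cone_base_continuous p (e : R) : 0 < cone_radius p -> 0 < e ->
  exists2 t : R, 0 < t & forall q, cone_dist p q < t ->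
    0 < cone_radius q /\ eucl_dist (cone_base p) (cone_base q) < e.
Proof.
move=> p0 e0; set r := cone_radius p in p0 *.
pose w := 1 - cos_pi e.
have w0 : 0 < w by rewrite subr_gt0 cos_pi_lt1.
(* The first bound keeps the radius of [q] above [r / 2]. With that, a base point at distance at
   least [e] would cost at least [2 * r * (r / 2) * w = r * r * w], which the second bound
   excludes. *)
pose t := Num.min (r / 2) (Num.sqrt (r * r * w)).
have t0 : 0 < t.
  by rewrite lt_min divr_gt0//= sqrtr_gt0 !mulr_gt0.
exists t => // q qt.
have qr : r / 2 < cone_radius q.
  have := le_lt_trans (dist_radius_le p q) qt.
  rewrite lt_min => /andP[+ _]; rewrite -/r ltr_norml => /andP[_]; lra.
have q0 : 0 < cone_radius q by apply: lt_trans qr; rewrite divr_gt0.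
split => //; rewrite ltNge; apply/negP => eL.
have : cone_dist p q ^+ 2 < r * r * w.
  have -> : r * r * w = Num.sqrt (r * r * w) ^+ 2.
    by rewrite sqr_sqrtr// ltW// !mulr_gt0.
  rewrite ltrXn2r// ?sqrtr_ge0//.
  by apply: lt_le_trans qt _; rewrite ge_min lexx orbT.
rewrite cone_dist_sqrE -/r ltNge => /negP; apply.
have cw : w <= 1 - cos_pi (eucl_dist (cone_base p) (cone_base q)).
  by rewrite lerD2l lerN2 cos_pi_nonincreasing// ltW.
apply: le_trans (_ : 2 * r * cone_radius q * w <= _); last first.
  apply: le_trans (_ : 2 * r * cone_radius q *
    (1 - cos_pi (eucl_dist (cone_base p) (cone_base q))) <= _).
    by rewrite ler_wpM2l// !mulr_ge0// ltW.
  by rewrite lerDr sqr_ge0.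
rewrite ler_wpM2r ?(ltW w0)//; nra.
Qed.

End cone_metric.

(** * Borel measurability on the cone *)

Section borel_measurability.
Context {R : realType} {d : nat}.

Lemma open_measurable_rV (U : set 'rV[R]_d) :
  open U -> measurable (U : set (borel_rV R d)).
Proof. exact: sub_sigma_algebra. Qed.

Lemma closed_measurable_rV (U : set 'rV[R]_d) :
  closed U -> measurable (U : set (borel_rV R d)).
Proof.
by rewrite -openC => /open_measurable_rV /measurableC; rewrite setCK.
Qed.

Lemma cone_open_measurable (U : set (cone R d)) :
  cone_open U -> measurable (U : set (borel_cone R d)).
Proof. exact: sub_sigma_algebra. Qed.

Lemma within_continuous_measurable_rV (D : set 'rV[R]_d) (f : 'rV[R]_d -> R) :
  measurable (D : set (borel_rV R d)) -> {within D, continuous f} ->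
  measurable_fun (D : set (borel_rV R d)) (f : borel_rV R d -> R).
Proof.
move=> mD /continuousP cf.
apply: (measurability _ (RGenOpens.measurableE R)) => _ [_ [a [b ->] <-]].
have oab : open (`]a, b[%classic : set R) by exact: interval_open.
have /open_subspaceP[V oV VE] := cf _ oab.
by rewrite setIC -VE; apply: measurableI => //; exact: open_measurable_rV.
Qed.

Lemma continuous_measurable_rV (f : 'rV[R]_d -> R) : continuous f ->
  measurable_fun setT (f : borel_rV R d -> R).
Proof.
move=> cf; apply: within_continuous_measurable_rV => //.
exact: continuous_subspaceT.
Qed.

Lemma measurable_cone_radius :
  measurable_fun setT (@cone_radius R d : borel_cone R d -> R).
Proof.
apply: (measurability _ (RGenOInfty.measurableE R)) => _ [_ [a ->] <-].
rewrite setTI; apply: cone_open_measurable => p /=.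
rewrite in_itv/= andbT => ap; exists (cone_radius p - a); first by rewrite subr_gt0.
move=> q pq; rewrite in_itv/= andbT.
have := le_lt_trans (dist_radius_le p q) pq.
rewrite ltr_norml => /andP[_]; lra.
Qed.

(* [cone_base] is [repr]-chosen at the apex; fixing its value there makes it a
   Borel map. *)
Definition cone_base0 (p : cone R d) : 'rV[R]_d :=
  if cone_radius p == 0 then 0 else cone_base p.

Lemma measurable_apex :
  measurable ([set p | cone_radius p = 0] : set (borel_cone R d)).
Proof.
have := measurable_cone_radius measurableT (measurable_set1 (0:R)).
by rewrite setTI.
Qed.

(** The preimage of an open [U] is a cone-open set of points of positive radius, by
    [cone_base_continuous], together with the apex exactly when [U] contains 0. *)
Lemma measurable_cone_base0 :
  measurable_fun setT (cone_base0 : borel_cone R d -> borel_rV R d).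
Proof.
apply: (@measurability _ _ (borel_cone R d) (borel_rV R d) setT cone_base0
  (@open 'rV[R]_d) erefl) => _ [U oU <-].
rewrite setTI.
have mV : measurable ([set p | 0 < cone_radius p /\ U (cone_base p)]
    : set (borel_cone R d)).
  apply: cone_open_measurable => p /= [p0 Up].
  have /nbhs_ballP[e /= e0 eU] : nbhs (cone_base p) U by exact: open_nbhs_nbhs.
  have [t t0 tP] := cone_base_continuous p0 e0.
  exists t => // q /tP[q0 pq]; split => //; apply: eU.
  rewrite -ball_normE /ball_/=.
  by apply: le_lt_trans pq; exact: sup_norm_le_eucl_dist.
have -> : cone_base0 @^-1` U =
    [set p | 0 < cone_radius p /\ U (cone_base p)] `|`
    ([set p | cone_radius p = 0] `&` [set p | U 0]).
  apply/seteqP; split => p; rewrite /cone_base0 /=.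
    case: eqP => [p0 U0|/eqP p0 Up]; first by right.
    by left; rewrite lt_neqAle eq_sym p0 cone_radius_ge0.
  move=> [[p0 Up]|[-> U0]]; last by rewrite eqxx.
  by rewrite gt_eqF.
apply: measurableU => //; have [U0|U0] := pselect (U 0).
  rewrite (_ : [set p | U 0] = setT) ?setIT; first exact: measurable_apex.
  by apply/seteqP; split.
by rewrite (_ : [set p | U 0] = set0) ?setI0//; apply/seteqP; split.
Qed.

Lemma measurable_cone_over (Omega : set 'rV[R]_d) :
  measurable (Omega : set (borel_rV R d)) ->
  measurable (cone_over Omega : set (borel_cone R d)).
Proof.
(* The cone over the empty set has no apex, whereas any point [x0] of [Omega] puts the apex in the
   cone; hence the case split. *)
move=> mO; have [->|/set0P[x0 Ox0]] := eqVneq Omega set0.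
  by rewrite (_ : cone_over set0 = set0)//; apply/seteqP; split => // p [].
have -> : cone_over Omega = [set p | cone_radius p = 0] `|`
    (cone_base0 @^-1` Omega `&` ~` [set p | cone_radius p = 0]).
  apply/seteqP; split => p /=.
    move=> [x Ox [r _ <-]]; rewrite cone_radiusE.
    have [r0|r0] := pselect (r%:num = 0); [by left|right; split => //].
    rewrite /cone_base0 cone_radiusE; move/eqP/negbTE : (r0) ->.
    rewrite cone_base_pt// lt_neqAle eq_sym ge0//.
    by apply/andP; split => //; apply/eqP.
  move=> [p0|[Op /eqP/negbTE p0]].
    exists x0 => //; exists (repr p).2 => //.
    rewrite -[RHS]cone_ptK; apply/eqmodP; rewrite /= /cone_rel/=.
    by rewrite -/(cone_radius p) p0 eqxx orbT.
  move: Op; rewrite /cone_base0 p0 => Op.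
  by exists (cone_base p) => //; exists (repr p).2 => //; exact: cone_ptK.
apply: measurableU; first exact: measurable_apex.
apply: measurableI; last exact: measurableC measurable_apex.
by rewrite -[X in measurable X]setTI; exact: measurable_cone_base0.
Qed.

(** At a fixed radius, the cone distance between the points over [x] and [y] tends to 0 as [y] tends
    to [x]; so cone-open sets pull back to open sets. *)
Lemma measurable_cone_pt (s : {nonneg R}) :
  measurable_fun setT
    ((fun x => cone_pt x s) : borel_rV R d -> borel_cone R d).
Proof.
apply: (@measurability _ _ (borel_rV R d) (borel_cone R d) setT
  (fun x => cone_pt x s) (@cone_open R d) erefl) => _ [U oU <-].
rewrite setTI; suff : open [set x : 'rV[R]_d | U (cone_pt x s)].
  exact: open_measurable_rV.
rewrite openE => x /= /oU[e e0 eU].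
rewrite /interior; near=> y; apply: eU; rewrite cone_distE; near: y.
pose g y := s%:num ^+ 2 + s%:num ^+ 2 - 2 * s%:num * s%:num *
  cos_pi (eucl_dist x y).
have cg : {for x, continuous g}.
  apply: continuousB; first exact: cst_continuous.
  apply: continuousM; first exact: cst_continuous.
  exact: (continuous_comp (@continuous_eucl_dist _ _ x x)
    (@continuous_cos_pi _ _)).
have g0 : g x = 0 by rewrite /g eucl_distxx cos_pi0; ring.
have : Num.sqrt (g y) @[y --> x] --> (0 : R).
  rewrite -[X in _ --> X]sqrtr0 -g0.
  exact: (continuous_comp cg (@sqrt_continuous R (g x))).
by move=> /cvgr_lt; apply.
Unshelve. all: by end_near. Qed.

(** Built on [cone_base0] rather than [cone_base] to be Borel; the cost is the same, because both
    radii multiply the angle and one of them vanishes at the apex. *)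
Definition cone_angle (pq : cone R d * cone R d) : R :=
  1 - cos_pi (eucl_dist (cone_base0 pq.1) (cone_base0 pq.2)).

Lemma cone_angle_ge0 pq : 0 <= cone_angle pq.
Proof. by rewrite subr_ge0 cos_pi_le1. Qed.

Lemma cone_dist_sqr_angle (pq : cone R d * cone R d) :
  cone_dist pq.1 pq.2 ^+ 2 = (cone_radius pq.1 - cone_radius pq.2) ^+ 2 +
    2 * cone_radius pq.1 * cone_radius pq.2 * cone_angle pq.
Proof.
rewrite cone_dist_sqrE /cone_angle /cone_base0.
case: eqP => [->|_]; first by rewrite !(mulr0,mul0r).
by case: eqP => [->|_] //; rewrite !(mulr0,mul0r).
Qed.

Local Notation cone2 := (borel_cone R d * borel_cone R d)%type.

Lemma measurable_radius_fst : measurable_fun setT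
  (fun pq : cone2 => cone_radius (pq.1 : cone R d)).
Proof. exact: (measurableT_comp measurable_cone_radius). Qed.

Lemma measurable_radius_snd : measurable_fun setT
  (fun pq : cone2 => cone_radius (pq.2 : cone R d)).
Proof. exact: (measurableT_comp measurable_cone_radius). Qed.

Lemma measurable_cone_angle :
  measurable_fun setT (cone_angle : cone2 -> R).
Proof.
have mcoord i : measurable_fun setT
    (fun x : borel_rV R d => (x : 'rV[R]_d) 0 i).
  by apply: continuous_measurable_rV; exact: coord_continuous.
apply: measurable_funB => //.
apply: (measurableT_comp (continuous_measurable_fun (@continuous_cos_pi R))).
apply: (measurableT_comp (continuous_measurable_fun (@sqrt_continuous R))).
apply: measurable_sum => i; apply: measurable_funX; apply: measurable_funB.
  apply: (measurableT_comp (mcoord i)).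
  exact: (measurableT_comp measurable_cone_base0).
apply: (measurableT_comp (mcoord i)).
exact: (measurableT_comp measurable_cone_base0).
Qed.

Lemma measurable_cone_dist_sqr :
  measurable_fun setT (fun pq : cone2 => cone_dist pq.1 pq.2 ^+ 2).
Proof.
rewrite (_ : (fun pq : cone2 => _) = fun pq : cone2 =>
  (cone_radius pq.1 - cone_radius pq.2) ^+ 2 +
    2 * cone_radius pq.1 * cone_radius pq.2 * cone_angle pq); last first.
  by apply/funext => pq; exact: cone_dist_sqr_angle.
have m1 := measurable_radius_fst; have m2 := measurable_radius_snd.
apply: measurable_funD.
  by apply: measurable_funX; exact: measurable_funB.
apply: measurable_funM; last exact: measurable_cone_angle.
by apply: measurable_funM => //; exact: measurable_funM.
Qed.

End borel_measurability.

(** * Transport cost of lifted couplings *)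

Lemma ge0_integral_conull d (T : measurableType d) (R : realType)
    (mu : {measure set T -> \bar R}) (D : set T) (f : T -> \bar R) :
  measurable D -> mu (~` D) = 0%E -> measurable_fun setT f ->
  (forall x, 0%E <= f x)%E -> (\int[mu]_x f x = \int[mu]_(x in D) f x)%E.
Proof.
move=> mD muD mf f0.
rewrite (ge0_negligible_integral (measurableC mD))//.
by rewrite setDE setCK setTI.
Qed.

Section couplings_theory.
Context {R : realType} {d : nat}.
Variables (Omega : set 'rV[R]_d).
Hypothesis mOmega : measurable (Omega : set (borel_rV R d)).
Implicit Types (mu : finite_borel R d) (lambda : finite_borel_cone R d).

Local Notation cone2 := (borel_cone R d * borel_cone R d)%type.
Implicit Type gamma : {measure set cone2 -> \bar R}.

Definition transport_cost gamma : \bar R :=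
  (\int[gamma]_pq (cone_dist pq.1 pq.2 ^+ 2)%:E)%E.

Definition lifted_coupling mu0 mu1 lambda0 lambda1 gamma : Prop :=
  [/\ cone_measures2 Omega lambda0, cone_measures2 Omega lambda1,
      is_cone_proj Omega lambda0 mu0, is_cone_proj Omega lambda1 mu1 &
      couplings lambda0 lambda1 gamma].

Lemma transport_cost_ge0 gamma : (0 <= transport_cost gamma)%E.
Proof. by apply: integral_ge0 => pq _; rewrite lee_fin sqr_ge0. Qed.

(** [HK_ge], [HK_le] and [HK_lt] translate the two nested infima and the square root into statements
    on the squared cost of single lifted couplings. *)
Lemma HK_ge mu0 mu1 (r : R) : 0 <= r ->
  (forall lambda0 lambda1 gamma,
    lifted_coupling mu0 mu1 lambda0 lambda1 gamma ->
    ((r ^+ 2)%:E <= transport_cost gamma)%E) ->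
  (r%:E <= HK Omega mu0 mu1)%E.
Proof.
move=> r0 h; apply: le_ereal_inf_tmp => _ [[l0 l1] /= [m0 m1 p0 p1] <-].
rewrite /W_cone -[r%:E]gee0_abs// -sqrte_sqr -EFin_expe lee_sqrt; last first.
  by apply: le_ereal_inf_tmp => _ [g _ <-]; exact: transport_cost_ge0.
by apply: le_ereal_inf_tmp => _ [g gc <-]; exact: (h l0 l1).
Qed.

Lemma HK_le mu0 mu1 lambda0 lambda1 gamma (r : R) : 0 <= r ->
  lifted_coupling mu0 mu1 lambda0 lambda1 gamma ->
  (transport_cost gamma <= (r ^+ 2)%:E)%E -> (HK Omega mu0 mu1 <= r%:E)%E.
Proof.
move=> r0 [m0 m1 p0 p1 gc] cr.
apply: (@le_trans _ _ (W_cone lambda0 lambda1)).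
  by apply: ereal_inf_lbound; exists (lambda0, lambda1).
rewrite /W_cone -[r%:E]gee0_abs// -sqrte_sqr -EFin_expe lee_sqrt; last first.
  by rewrite lee_fin sqr_ge0.
by apply: le_trans cr; apply: ereal_inf_lbound; exists gamma.
Qed.

Lemma HK_lt mu0 mu1 (r : R) : (HK Omega mu0 mu1 < r%:E)%E ->
  exists lambda0 lambda1 gamma, lifted_coupling mu0 mu1 lambda0 lambda1 gamma /\
    (transport_cost gamma < (r ^+ 2)%:E)%E.
Proof.
move=> /ereal_inf_lt[_ [[l0 l1] /= [m0 m1 p0 p1] <-]] Wr.
have r0 : 0 < r by rewrite -lte_fin; apply: le_lt_trans Wr; exact: sqrte_ge0.
have : (ereal_inf [set transport_cost g | g in couplings l0 l1]
    < (r ^+ 2)%:E)%E.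
  rewrite ltNge -lee_sqrt; last first.
    by apply: le_ereal_inf_tmp => _ [g _ <-]; exact: transport_cost_ge0.
  rewrite EFin_expe sqrte_sqr (gee0_abs (ltW _)) ?lte_fin//.
  by rewrite -ltNge.
by move=> /ereal_inf_lt[_ [g gc <-]] gr; exists l0, l1, g.
Qed.

Lemma coupling_integral_fst lambda0 lambda1 gamma (f : borel_cone R d -> \bar R) :
  couplings lambda0 lambda1 gamma -> measurable_fun setT f ->
  (forall p, 0 <= f p)%E ->
  (\int[gamma]_pq f pq.1 = \int[lambda0]_p f p)%E.
Proof.
move=> [g0 _] mf f0.
rewrite -(@eq_measure_integral _ _ _ setT lambda0
  (pushforward gamma (fst : cone2 -> borel_cone R d))); last first.
  by move=> A mA _; exact: g0.
by rewrite [RHS]ge0_integral_pushforward.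
Qed.

Lemma coupling_integral_snd lambda0 lambda1 gamma (f : borel_cone R d -> \bar R) :
  couplings lambda0 lambda1 gamma -> measurable_fun setT f ->
  (forall p, 0 <= f p)%E ->
  (\int[gamma]_pq f pq.2 = \int[lambda1]_p f p)%E.
Proof.
move=> [_ g1] mf f0.
rewrite -(@eq_measure_integral _ _ _ setT lambda1
  (pushforward gamma (snd : cone2 -> borel_cone R d))); last first.
  by move=> A mA _; exact: g1.
by rewrite [RHS]ge0_integral_pushforward.
Qed.

Lemma measurable_radius_base (phi : 'rV[R]_d -> R) :
  measurable_fun setT (phi : borel_rV R d -> R) ->
  measurable_fun setT ((fun p => cone_radius p ^+ 2 * phi (cone_base0 p))
    : borel_cone R d -> R).
Proof.
move=> mphi; apply: measurable_funM.
  by apply: measurable_funX; exact: measurable_cone_radius.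
exact: (measurableT_comp mphi measurable_cone_base0).
Qed.

(** Trades the integral over [cone_over Omega] with [cone_base] for a total integral with the Borel
    map [cone_base0]: the complement is null, and at the apex the factor [cone_radius p ^+ 2] kills
    the difference. *)
Lemma cone_proj_integral lambda mu (phi : 'rV[R]_d -> R) :
  cone_measures2 Omega lambda -> is_cone_proj Omega lambda mu ->
  continuous phi -> (forall x, 0 <= phi x) ->
  (\int[lambda]_p (cone_radius p ^+ 2 * phi (cone_base0 p))%:E =
   \int[mu]_(x in Omega) (phi x)%:E)%E.
Proof.
move=> [l0 _] lmu cphi phi0; rewrite lmu; last exact: continuous_subspaceT.
have mC := measurable_cone_over mOmega.
rewrite (ge0_integral_conull mC l0); last 2 first.
- apply/measurable_EFinP; apply: measurable_radius_base.
  exact: continuous_measurable_rV.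
- by move=> p; rewrite lee_fin mulr_ge0 ?sqr_ge0.
apply: eq_integral => p _; rewrite /cone_base0; case: eqP => // ->.
by rewrite expr0n !mul0r.
Qed.

(** * Integral identity for the excess of a lifted coupling *)

Section excess.
Variables (mu0 mu1 : finite_borel R d) (lambda0 lambda1 : finite_borel_cone R d)
  (gamma : {measure set (borel_cone R d * borel_cone R d)%type -> \bar R}).
Hypothesis gammaP : lifted_coupling mu0 mu1 lambda0 lambda1 gamma.

Lemma lifted_coupling_integral_fst (phi : 'rV[R]_d -> R) :
  continuous phi -> (forall x, 0 <= phi x) ->
  (\int[gamma]_pq
     (cone_radius pq.1 ^+ 2 * phi (cone_base0 (pq.1 : cone R d)))%:E =
   \int[mu0]_(x in Omega) (phi x)%:E)%E.
Proof.
move=> cphi phi0; have [m0 _ p0 _ gc] := gammaP.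
rewrite -(cone_proj_integral m0 p0 cphi phi0).
rewrite (coupling_integral_fst (f := fun p : borel_cone R d =>
  (cone_radius (p : cone R d) ^+ 2 * phi (cone_base0 p))%:E) gc)//.
  apply/measurable_EFinP; apply: measurable_radius_base.
  exact: continuous_measurable_rV.
by move=> p; rewrite lee_fin mulr_ge0 ?sqr_ge0.
Qed.

Lemma lifted_coupling_integral_snd (phi : 'rV[R]_d -> R) :
  continuous phi -> (forall x, 0 <= phi x) ->
  (\int[gamma]_pq
     (cone_radius pq.2 ^+ 2 * phi (cone_base0 (pq.2 : cone R d)))%:E =
   \int[mu1]_(x in Omega) (phi x)%:E)%E.
Proof.
move=> cphi phi0; have [_ m1 _ p1 gc] := gammaP.
rewrite -(cone_proj_integral m1 p1 cphi phi0).
rewrite (coupling_integral_snd (f := fun p : borel_cone R d =>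
  (cone_radius (p : cone R d) ^+ 2 * phi (cone_base0 p))%:E) gc)//.
  apply/measurable_EFinP; apply: measurable_radius_base.
  exact: continuous_measurable_rV.
by move=> p; rewrite lee_fin mulr_ge0 ?sqr_ge0.
Qed.

Lemma lifted_coupling_radius_fst :
  (\int[gamma]_pq (cone_radius pq.1 ^+ 2)%:E = mu0 Omega)%E.
Proof.
rewrite -[RHS]mul1e -(integral_cst mu0 mOmega).
rewrite -(@lifted_coupling_integral_fst (fun=> 1))//; last exact: cst_continuous.
by apply: eq_integral => pq _; rewrite mulr1.
Qed.

Lemma lifted_coupling_radius_snd :
  (\int[gamma]_pq (cone_radius pq.2 ^+ 2)%:E = mu1 Omega)%E.
Proof.
rewrite -[RHS]mul1e -(integral_cst mu1 mOmega).
rewrite -(@lifted_coupling_integral_snd (fun=> 1))//; last exact: cst_continuous.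
by apply: eq_integral => pq _; rewrite mulr1.
Qed.

(* The defect in [d^2 >= (1 - theta) r0^2 + (1 - 1 / theta) r1^2]. *)
Definition dist_excess (theta : R) (pq : cone R d * cone R d) : R :=
  theta^-1 * (theta * cone_radius pq.1 - cone_radius pq.2) ^+ 2 +
  2 * cone_radius pq.1 * cone_radius pq.2 * cone_angle pq.

Lemma dist_excess_ge0 theta pq : 0 < theta -> 0 <= dist_excess theta pq.
Proof.
move=> t0; apply: addr_ge0; apply: mulr_ge0.
- by rewrite invr_ge0 ltW.
- exact: sqr_ge0.
- by rewrite !mulr_ge0 ?cone_radius_ge0.
- exact: cone_angle_ge0.
Qed.

Lemma measurable_dist_excess theta :
  measurable_fun setT (dist_excess theta : cone2 -> R).
Proof.
have m1 := @measurable_radius_fst R d; have m2 := @measurable_radius_snd R d.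
apply: measurable_funD.
  apply: measurable_funM => //; apply: measurable_funX.
  by apply: measurable_funB => //; exact: measurable_funM.
apply: measurable_funM; last exact: measurable_cone_angle.
by apply: measurable_funM => //; exact: measurable_funM.
Qed.

(** Integrates the pointwise identity [d^2 + theta r0^2 + theta^-1 r1^2 = r0^2 + r1^2 + excess].
    Only sums of nonnegative functions occur, so additivity of the integral applies without a
    finiteness check on the cost. *)
Lemma transport_cost_excess (theta a b : R) : 0 < theta ->
  mu0 Omega = a%:E -> mu1 Omega = b%:E ->
  (transport_cost gamma + (theta * a + theta^-1 * b)%:E =
   (a + b)%:E + \int[gamma]_pq (dist_excess theta pq)%:E)%E.
Proof.
move=> t0 mua mub.
have t0' := ltW t0; have ti0 : 0 <= theta^-1 by rewrite invr_ge0.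
have m1 := @measurable_radius_fst R d; have m2 := @measurable_radius_snd R d.
have md := @measurable_cone_dist_sqr R d.
have me := measurable_dist_excess theta.
have m1' : measurable_fun setT
    (fun pq : cone2 => cone_radius (pq.1 : cone R d) ^+ 2).
  exact: measurable_funX.
have m2' : measurable_fun setT
    (fun pq : cone2 => cone_radius (pq.2 : cone R d) ^+ 2).
  exact: measurable_funX.
have E1 : (\int[gamma]_pq (theta * cone_radius pq.1 ^+ 2)%:E =
    (theta * a)%:E)%E.
  under eq_integral do rewrite EFinM.
  rewrite ge0_integralZl_EFin//; last 2 first.
  - by move=> pq _; rewrite lee_fin sqr_ge0.
  - exact/measurable_EFinP.
  by rewrite lifted_coupling_radius_fst mua EFinM.
have E2 : (\int[gamma]_pq (theta^-1 * cone_radius pq.2 ^+ 2)%:E =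
    (theta^-1 * b)%:E)%E.
  under eq_integral do rewrite EFinM.
  rewrite ge0_integralZl_EFin//; last 2 first.
  - by move=> pq _; rewrite lee_fin sqr_ge0.
  - exact/measurable_EFinP.
  by rewrite lifted_coupling_radius_snd mub EFinM.
have mt1 : measurable_fun setT
    (fun pq : cone2 => theta * cone_radius (pq.1 : cone R d) ^+ 2).
  exact: measurable_funM.
have mt2 : measurable_fun setT
    (fun pq : cone2 => theta^-1 * cone_radius (pq.2 : cone R d) ^+ 2).
  exact: measurable_funM.
transitivity (\int[gamma]_pq ((cone_dist pq.1 pq.2 ^+ 2)%:E +
    ((theta * cone_radius pq.1 ^+ 2)%:E +
     (theta^-1 * cone_radius pq.2 ^+ 2)%:E)))%E.
  rewrite ge0_integralD//; last 4 first.
  - by move=> pq _; rewrite lee_fin sqr_ge0.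
  - exact/measurable_EFinP.
  - by move=> pq _; rewrite -EFinD lee_fin addr_ge0 ?mulr_ge0 ?cone_radius_ge0.
  - by apply: emeasurable_funD; exact/measurable_EFinP.
  congr (_ + _)%E; rewrite ge0_integralD//; last 4 first.
  - by move=> pq _; rewrite lee_fin mulr_ge0 ?sqr_ge0.
  - exact/measurable_EFinP.
  - by move=> pq _; rewrite lee_fin mulr_ge0 ?sqr_ge0.
  - exact/measurable_EFinP.
  by rewrite E1 E2.
transitivity (\int[gamma]_pq ((cone_radius pq.1 ^+ 2)%:E +
    (cone_radius pq.2 ^+ 2)%:E + (dist_excess theta pq)%:E))%E.
  apply: eq_integral => pq _; rewrite -!EFinD; congr EFin.
  rewrite cone_dist_sqr_angle /dist_excess.
  by field; rewrite gt_eqF.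
rewrite ge0_integralD//; last 4 first.
- by move=> pq _; rewrite -EFinD lee_fin addr_ge0 ?sqr_ge0.
- by apply: emeasurable_funD; exact/measurable_EFinP.
- by move=> pq _; rewrite lee_fin dist_excess_ge0.
- exact/measurable_EFinP.
congr (_ + _)%E; rewrite ge0_integralD//; last 4 first.
- by move=> pq _; rewrite lee_fin sqr_ge0.
- exact/measurable_EFinP.
- by move=> pq _; rewrite lee_fin sqr_ge0.
- exact/measurable_EFinP.
by rewrite lifted_coupling_radius_fst lifted_coupling_radius_snd mua mub.
Qed.

End excess.

(** For positive [a] and [b] the left side at [theta = b / a] is exactly [(a - b) ^+ 2]. If [a = 0]
    or [b = 0], the bound is only approached, as [theta] tends to infinity or to 0. *)
Lemma le_sqr_of_scaled (a b C : R) : 0 <= a -> 0 <= b ->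
  (forall theta, 0 < theta ->
    (1 - theta) * a ^+ 2 + (1 - theta^-1) * b ^+ 2 <= C) ->
  (a - b) ^+ 2 <= C.
Proof.
rewrite le_eqVlt => /predU1P[<-|a0].
  move=> b0 h; rewrite sub0r sqrrN; apply/ler_addgt0Pl => e e0.
  (* This large [theta] makes the loss [theta^-1 * b ^+ 2] at most [e]. *)
  have t0 : 0 < b ^+ 2 / e + 1.
    by rewrite ltr_wpDl// divr_ge0 ?sqr_ge0// ltW.
  have := h _ t0; rewrite expr0n mulr0 add0r mulrBl mul1r => hC.
  have : (b ^+ 2 / e + 1)^-1 * b ^+ 2 <= e.
    rewrite mulrC ler_pdivrMr// mulrDr mulr1 mulrC divfK ?gt_eqF//.
    by rewrite lerDl ltW.
  lra.
rewrite le_eqVlt => /predU1P[<-|b0] h.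
  rewrite subr0; apply/ler_addgt0Pl => e e0.
  (* This small [theta] makes the loss [theta * a ^+ 2] equal to [e]. *)
  have t0 : 0 < e / a ^+ 2 by rewrite divr_gt0 ?exprn_gt0.
  have := h _ t0; rewrite expr0n mulr0 addr0 mulrBl mul1r divfK ?gt_eqF ?exprn_gt0//.
  lra.
apply: le_trans (h (b / a) (divr_gt0 b0 a0)).
rewrite le_eqVlt; apply/orP; left; apply/eqP.
by field; rewrite !gt_eqF.
Qed.

(** Dropping the nonnegative excess integral from [transport_cost_excess] leaves the family of
    bounds in [le_sqr_of_scaled]; an infinite cost is trivial. *)
Lemma transport_cost_ge mu0 mu1 lambda0 lambda1 gamma (a b : R) :
  0 <= a -> 0 <= b -> mu0 Omega = (a ^+ 2)%:E -> mu1 Omega = (b ^+ 2)%:E ->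
  lifted_coupling mu0 mu1 lambda0 lambda1 gamma ->
  (((a - b) ^+ 2)%:E <= transport_cost gamma)%E.
Proof.
move=> a0 b0 mua mub gP.
have := transport_cost_ge0 gamma.
have := fun theta (t0 : 0 < theta) => transport_cost_excess gP t0 mua mub.
case: (transport_cost gamma) => [c| |//] h _; last by rewrite leey.
rewrite lee_fin; apply: le_sqr_of_scaled => // theta t0.
have : (0 <= \int[gamma]_pq (dist_excess theta pq)%:E)%E.
  by apply: integral_ge0 => pq _; rewrite lee_fin dist_excess_ge0.
have := h _ t0; case: (\int[gamma]_pq (dist_excess theta pq)%:E)%E => [e| |]//=.
rewrite -!EFinD lee_fin => -[h1] h2; lra.
Qed.

End couplings_theory.

(** * The Hellinger curve *)

Section cone_lift.
Context {R : realType} {d : nat}.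
Variables (s : {nonneg R}) (mu : finite_borel R d).

(** A lift of [s^2 mu] carried by the single radius [s]. Even for [s = 0] it keeps the full mass of
    [mu], then placed at the apex, so the lifts for different radii can be coupled. *)
Definition cone_lift : set (borel_cone R d) -> \bar R :=
  pushforward mu ((fun x => cone_pt x s) : borel_rV R d -> borel_cone R d).

Let mpt := @measurable_cone_pt R d s.

Let cone_lift0 : cone_lift set0 = 0%E.
Proof. by rewrite /cone_lift /pushforward preimage_set0 measure0. Qed.

Let cone_lift_ge0 A : (0 <= cone_lift A)%E.
Proof. exact: measure_ge0. Qed.

Let cone_lift_sigma_additive : semi_sigma_additive cone_lift.
Proof. exact: measure_semi_sigma_additive. Qed.

HB.instance Definition _ := isMeasure.Build _ _ _ cone_lift
  cone_lift0 cone_lift_ge0 cone_lift_sigma_additive.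

Let cone_lift_fin : fin_num_fun cone_lift.
Proof.
move=> A mA; apply: (@fin_num_measure _ _ _ mu).
by rewrite -[X in measurable X]setTI; exact: mpt.
Qed.

HB.instance Definition _ := Measure_isFinite.Build _ _ _ cone_lift cone_lift_fin.

End cone_lift.

(** * Distances between multiples of one measure *)

Section hellinger_curve_cost.
Context {R : realType} {d : nat}.
Variables (Omega : set 'rV[R]_d) (mu : finite_borel R d).
Hypothesis mOmega : measurable (Omega : set (borel_rV R d)).
Hypothesis mu_Omega : measures_on Omega mu.

Lemma cone_over_pt (x : 'rV[R]_d) (s : {nonneg R}) : 0 < s%:num ->
  cone_over Omega (cone_pt x s) -> Omega x.
Proof.
move=> s0 [y Oy [r _ rE]].
have rs : r%:num = s%:num by rewrite -(cone_radiusE x s) -rE cone_radiusE.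
by rewrite -(cone_base_pt x s0) -rE cone_base_pt ?rs.
Qed.

Lemma cone_measures2_lift (s : {nonneg R}) :
  cone_measures2 Omega (cone_lift s mu).
Proof.
have mC := measurable_cone_over mOmega.
split.
  apply/eqP; rewrite -measure_le0 -mu_Omega.
  apply: (@le_measure _ _ _ mu ((fun x => cone_pt x s) @^-1` (~` cone_over Omega))
    (~` Omega)); rewrite ?inE.
  - rewrite -[X in measurable X]setTI; apply: measurable_cone_pt => //.
    exact: measurableC.
  - exact: measurableC.
  - by move=> x /= + Ox; apply; exists x => //; exists s.
rewrite ge0_integral_pushforward//; last 3 first.
- exact: measurable_cone_pt.
- apply/measurable_EFinP; apply: measurable_funX; exact: measurable_cone_radius.
- by move=> p _; rewrite lee_fin sqr_ge0.
rewrite (eq_integral (fun=> (s%:num ^+ 2)%:E)); last first.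
  by move=> x _ /=; rewrite cone_radiusE.
rewrite preimage_setT integral_cst// lte_mul_pinfty ?lee_fin ?sqr_ge0//.
by rewrite ltey_eq fin_num_measure.
Qed.

(** The factor [k] is tied to [s ^+ 2] by an equation only, so that it can be any nonnegative term
    of that value, such as the one in [hellinger_curve]. *)
Lemma cone_lift_proj_ge0 (s : {nonneg R}) (k : {nonneg R}) (phi : 'rV[R]_d -> R) :
  k%:num = s%:num ^+ 2 ->
  measurable_fun (Omega : set (borel_rV R d)) (phi : borel_rV R d -> R) ->
  (forall x, 0 <= phi x) ->
  (\int[mscale k mu]_(x in Omega) (phi x)%:E =
    \int[cone_lift s mu]_(p in cone_over Omega)
      (cone_radius p ^+ 2 * phi (cone_base p))%:E)%E.
Proof.
move=> ks mphi phi0.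
rewrite ge0_integral_mscale//; last 2 first.
- exact/measurable_EFinP.
- by move=> x _; rewrite lee_fin.
(* Extending [phi] by zero turns both sides into total integrals, to which the change of variables
   for the pushforward applies. *)
pose psi := (phi \_ Omega) : 'rV[R]_d -> R.
have mpsi : measurable_fun setT (psi : borel_rV R d -> R).
  by apply/(measurable_restrictT _ _).1.
have psi0 x : 0 <= psi x by rewrite /psi patchE; case: ifP.
rewrite [RHS]integral_mkcond.
rewrite [RHS](eq_integral (fun p : borel_cone R d =>
    (cone_radius (p : cone R d) ^+ 2 * psi (cone_base0 p))%:E)).
  rewrite [RHS]ge0_integral_pushforward//; last 3 first.
  - exact: measurable_cone_pt.
  - by apply/measurable_EFinP; exact: measurable_radius_base.
  - by move=> p _; rewrite lee_fin mulr_ge0 ?sqr_ge0.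
  rewrite integral_mkcond -ge0_integralZl_EFin//; last 2 first.
  - by move=> x _; rewrite patchE; case: ifP => //; rewrite lee_fin.
  - apply/(measurable_restrictT _ _).1 => //; exact/measurable_EFinP.
  rewrite preimage_setT; apply: eq_integral => x _ /=.
  rewrite cone_radiusE ks; have [s0|s0] := eqVneq s%:num 0.
    by rewrite s0 expr0n mul0r mul0e.
  rewrite /cone_base0 cone_radiusE (negbTE s0) cone_base_pt; last first.
    by rewrite lt_neqAle eq_sym s0/=.
  by rewrite /psi !patchE; case: ifP => _; rewrite ?mulr0 ?mule0 ?EFinM.
move=> p _; rewrite patchE /cone_base0.
have [p0|p0] := eqVneq (cone_radius p) 0.
  by rewrite p0 expr0n !mul0r; case: ifP.
rewrite /psi patchE -[in X in X = _](cone_ptK p).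
have pp : 0 < (repr p).2%:num.
  by rewrite -/(cone_radius p) lt_neqAle eq_sym p0 cone_radius_ge0.
case: ifPn; rewrite ?inE ?notin_setE.
  move=> /(cone_over_pt pp) Ob.
  by rewrite mem_set// cone_radiusE cone_base_pt.
move=> nC; rewrite memNset ?mulr0// => Ob; apply: nC.
by exists (cone_base p) => //; exists (repr p).2.
Qed.

(** Signed test functions reduce to nonnegative ones, since multiplication by the squared radius
    commutes with taking positive and negative parts. *)
Lemma is_cone_proj_lift (s : {nonneg R}) (k : {nonneg R}) :
  k%:num = s%:num ^+ 2 ->
  is_cone_proj Omega (cone_lift s mu) (mscale k mu).
Proof.
move=> ks phi cphi.
have mphi : measurable_fun (Omega : set (borel_rV R d)) (phi : borel_rV R d -> R).
  exact: within_continuous_measurable_rV.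
rewrite integralE [RHS]integralE; congr (_ - _)%E.
  transitivity (\int[mscale k mu]_(x in Omega) (phi^\+ x)%:E)%E.
    by apply: eq_integral => x _; rewrite funeposE /funrpos -EFin_max.
  rewrite (cone_lift_proj_ge0 ks); last 2 first.
  - exact: measurable_funrpos.
  - by move=> x; rewrite /funrpos le_max lexx orbT.
  apply: eq_integral => p _; rewrite funeposE /funrpos -EFin_max.
  by rewrite maxr_pMr ?sqr_ge0// mulr0.
transitivity (\int[mscale k mu]_(x in Omega) (phi^\- x)%:E)%E.
  by apply: eq_integral => x _; rewrite funenegE /funrneg -EFinN -EFin_max.
rewrite (cone_lift_proj_ge0 ks); last 2 first.
- exact: measurable_funrneg.
- by move=> x; rewrite /funrneg le_max lexx orbT.
apply: eq_integral => p _; rewrite funenegE /funrneg -EFinN -EFin_max.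
by rewrite maxr_pMr ?sqr_ge0// mulr0 mulrN.
Qed.

Lemma HK_scaled_le (s t k l : {nonneg R}) :
  k%:num = s%:num ^+ 2 -> l%:num = t%:num ^+ 2 ->
  (HK Omega (mscale k mu) (mscale l mu) <=
    (`|s%:num - t%:num| * Num.sqrt (fine (mu Omega)))%:E)%E.
Proof.
move=> ks lt.
pose f (x : borel_rV R d) : (borel_cone R d * borel_cone R d)%type :=
  (cone_pt x s, cone_pt x t).
have mf : measurable_fun setT f.
  by apply: measurable_fun_pair; exact: measurable_cone_pt.
have muT : mu setT = mu Omega.
  rewrite -(setUv Omega) measureU ?setICr//; last exact: measurableC.
  by rewrite -[RHS]adde0; congr (_ + _)%E; exact: mu_Omega.
apply: (@HK_le _ _ _ _ _ (cone_lift s mu) (cone_lift t mu)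
  (pushforward mu f)).
- by rewrite mulr_ge0 ?sqrtr_ge0.
- split; [exact: cone_measures2_lift|exact: cone_measures2_lift|
    exact: is_cone_proj_lift|exact: is_cone_proj_lift|by split].
rewrite /transport_cost ge0_integral_pushforward//; last 2 first.
- by apply/measurable_EFinP; exact: measurable_cone_dist_sqr.
- by move=> p _; rewrite lee_fin sqr_ge0.
rewrite (eq_integral (fun=> ((s%:num - t%:num) ^+ 2)%:E)).
  rewrite preimage_setT integral_cst// [X in (_ * X <= _)%E]muT exprMn.
  rewrite sqr_sqrtr ?fine_ge0//.
  by rewrite real_normK ?num_real// [leRHS]EFinM fineK// fin_num_measure.
move=> x _ /=; rewrite cone_distE eucl_distxx cos_pi0 mulr1; congr EFin.
rewrite (_ : _ - _ = (s%:num - t%:num) ^+ 2); last by ring.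
by rewrite sqr_sqrtr ?sqr_ge0.
Qed.

Lemma HK_scaled (s t k l : {nonneg R}) :
  k%:num = s%:num ^+ 2 -> l%:num = t%:num ^+ 2 ->
  HK Omega (mscale k mu) (mscale l mu) =
    (`|s%:num - t%:num| * Num.sqrt (fine (mu Omega)))%:E.
Proof.
move=> ks lt; apply/eqP; rewrite eq_le HK_scaled_le//=.
(* Masses are written as squares, so that [transport_cost_ge] returns the squared difference of
   their roots. *)
have mass (u h : {nonneg R}) : h%:num = u%:num ^+ 2 ->
    mscale h mu Omega = ((u%:num * Num.sqrt (fine (mu Omega))) ^+ 2)%:E.
  move=> hu; rewrite exprMn sqr_sqrtr ?fine_ge0// [RHS]EFinM -hu fineK//.
  by rewrite fin_num_measure.
apply: HK_ge; first by rewrite mulr_ge0 ?sqrtr_ge0.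
move=> l0 l1 g gP.
have := transport_cost_ge mOmega _ _ (mass _ _ ks) (mass _ _ lt) gP.
rewrite !mulr_ge0 ?sqrtr_ge0// => /(_ isT isT).
by rewrite -mulrBl !exprMn real_normK ?num_real.
Qed.

End hellinger_curve_cost.

(** * Uniqueness *)

Section test_functions.
Context {R : realType} {d : nat}.
Implicit Types (x y : 'rV[R]_d) (A : set 'rV[R]_d).

(** Distance in the sup norm. On an empty [A] the infimum is a mere default value, so the estimates
    below supply a point of [A]. *)
Definition set_dist A x : R := inf [set `|x - y| | y in A].

Lemma set_dist_lbound A x : lbound [set `|x - y| | y in A] 0.
Proof. by move=> _ [y _ <-]. Qed.

Lemma set_dist_ge0 A x : A !=set0 -> 0 <= set_dist A x.
Proof.
move=> [a Aa]; apply: lb_le_inf; last exact: set_dist_lbound.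
by exists `|x - a|; exists a.
Qed.

Lemma set_dist_le A x y : A y -> set_dist A x <= `|x - y|.
Proof.
move=> Ay; apply: ge_inf; first by exists 0; exact: set_dist_lbound.
by exists y.
Qed.

Lemma set_dist0 A x : A x -> set_dist A x = 0.
Proof.
move=> Ax; apply/eqP; rewrite eq_le set_dist_ge0; last by exists x.
by rewrite andbT (le_trans (set_dist_le x Ax))// subrr normr0.
Qed.

Lemma set_dist_gt0 A x : A !=set0 -> open (~` A) -> ~ A x -> 0 < set_dist A x.
Proof.
move=> [a Aa] oA nAx.
have /nbhs_ballP[e /= e0 eA] : nbhs x (~` A) by exact: open_nbhs_nbhs.
apply: lt_le_trans e0 _; apply: lb_le_inf; first by exists `|x - a|; exists a.
move=> _ [y Ay <-]; rewrite leNgt; apply/negP => xy; apply: (eA y) => //.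
by rewrite -ball_normE.
Qed.

Lemma set_dist_lipschitz A x y : A !=set0 ->
  set_dist A x - set_dist A y <= `|x - y|.
Proof.
move=> [a Aa]; rewrite lerBlDl -lerBlDr; apply: lb_le_inf.
  by exists `|y - a|; exists a.
move=> _ [z Az <-]; rewrite lerBlDr (le_trans (set_dist_le x Az))//.
by rewrite [leRHS]addrC ler_distD.
Qed.

(* These increase to the indicator function of the complement of [A] when [A]
   is closed. *)
Definition set_test A (n : nat) x : R := Num.min 1 (n%:R * set_dist A x).

Lemma set_test_ge0 A n x : A !=set0 -> 0 <= set_test A n x.
Proof. by move=> A0; rewrite le_min ler01 mulr_ge0 ?set_dist_ge0. Qed.

Lemma set_test_le1 A n x : set_test A n x <= 1.
Proof. by rewrite ge_min lexx. Qed.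

Lemma set_test_lipschitz A n x y : A !=set0 ->
  `|set_test A n x - set_test A n y| <= n%:R * `|x - y|.
Proof.
move=> A0.
suff H u v : set_test A n u - set_test A n v <= n%:R * `|u - v|.
  by rewrite ler_norml H lerNl opprB distrC H.
have := set_dist_lipschitz u v A0.
have := set_dist_ge0 u A0; have := set_dist_ge0 v A0.
have : (0 : R) <= n%:R by [].
have : 0 <= `|u - v| by [].
rewrite /set_test; move: (n%:R : R) => N; move: (set_dist A u) (set_dist A v).
move=> p q; move: `|u - v| => r r0 N0 q0 p0 pqr.
have h : N * p - N * q <= N * r by rewrite -mulrBr ler_wpM2l.
have nr : 0 <= N * r by rewrite mulr_ge0.
rewrite !minEle; do 2 case: ifPn; rewrite -?ltNge; lra.
Qed.

Lemma lipschitz_continuous (f : 'rV[R]_d -> R) (K : R) :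
  (forall x y, `|f x - f y| <= K * `|x - y|) -> continuous f.
Proof.
move=> fK x; apply/(cvgrPdist_lt (F := nbhs x)) => e e0.
have K0 : 0 < `|K| + 1 by rewrite ltr_wpDl.
near=> y; apply: (le_lt_trans (fK x y)).
have xy : `|x - y| < e / (`|K| + 1).
  near: y; apply/nbhs_ballP; exists (e / (`|K| + 1)) => /=.
    by rewrite divr_gt0.
  by move=> z; rewrite -ball_normE.
apply: (@le_lt_trans _ _ ((`|K| + 1) * `|x - y|)).
  by rewrite ler_wpM2r// ler_wpDr// ler_norm.
by rewrite mulrC -ltr_pdivlMr.
Unshelve. all: by end_near. Qed.

End test_functions.

(** * Weighted differences of test functions against the excess *)

Section pointwise_estimate.
Context {R : realType}.

(** Rests on [a^2 u - b^2 v = (a - b) (a u + b v) + a b (u - v)]. The first product is split by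
    Young's inequality with weight [delta], costing [2 * delta]; the second uses the modulus of
    [u - v], costing one more [delta]. *)
Lemma weighted_difference_le (a b u v w delta C : R) :
  0 <= a -> 0 <= b -> 0 <= u <= 1 -> 0 <= v <= 1 -> 0 <= w ->
  0 < delta -> 0 <= C -> `|u - v| <= delta + C * w ->
  a ^+ 2 * u <= b ^+ 2 * v + 3 * delta * (a ^+ 2 + b ^+ 2) +
    (delta^-1 + C) * ((a - b) ^+ 2 + 2 * a * b * w).
Proof.
move=> a0 b0 /andP[u0 u1] /andP[v0 v1] w0 d0 C0 uv.
have di0 : 0 < delta^-1 by rewrite invr_gt0.
have H1 : (a - b) * (a * u + b * v) <=
    delta^-1 * (a - b) ^+ 2 + 2 * delta * (a ^+ 2 + b ^+ 2).
  apply: (@le_trans _ _ (`|a - b| * (a + b))).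
    apply: (@le_trans _ _ (`|a - b| * (a * u + b * v))).
      by rewrite ler_wpM2r ?ler_norm// addr_ge0// mulr_ge0.
    by rewrite ler_wpM2l// lerD// ler_piMr.
  rewrite -(real_normK (num_real (a - b))).
  move: `|a - b| (normr_ge0 (a - b)) => t t0.
  (* Young's inequality for [t * (a + b)], as the nonnegativity of a square. *)
  have : 0 <= delta^-1 * (t - delta * (a + b)) ^+ 2.
    by rewrite mulr_ge0 ?sqr_ge0 ?ltW.
  have -> : delta^-1 * (t - delta * (a + b)) ^+ 2 =
      delta^-1 * t ^+ 2 - 2 * (t * (a + b)) + delta * (a + b) ^+ 2.
    by field; rewrite gt_eqF.
  have : 0 <= delta * (a - b) ^+ 2 by rewrite mulr_ge0 ?sqr_ge0 ?ltW.
  have : 0 <= t * (a + b) by rewrite mulr_ge0// addr_ge0.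
  nra.
have H2 : a * b * (u - v) <= a * b * (delta + C * w).
  by rewrite ler_wpM2l ?mulr_ge0// (le_trans (ler_norm _)).
have H3 : a * b * delta <= delta * (a ^+ 2 + b ^+ 2).
  have : 0 <= delta * (a - b) ^+ 2 by rewrite mulr_ge0 ?sqr_ge0 ?ltW.
  have : 0 <= delta * (a * b) by rewrite !mulr_ge0// ltW.
  nra.
(* Surplus terms that pad the bound up to a full multiple of [(a - b) ^+ 2 + 2 * a * b * w]. *)
have H4 : 0 <= C * (a - b) ^+ 2 by rewrite mulr_ge0 ?sqr_ge0.
have H5 : 0 <= C * (a * b * w) by rewrite !mulr_ge0.
have H6 : 0 <= delta^-1 * (a * b * w) by rewrite !mulr_ge0// ltW.
nra.
Qed.

(** Within distance [eta] the Lipschitz bound gives [delta]. Beyond [eta] the oscillation of [phi]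
    is at most 1 while [1 - cos_pi] is at least [1 - cos_pi eta], so the inverse of the latter
    serves as [C]. *)
Lemma lipschitz_cos_pi_modulus (d : nat) (phi : 'rV[R]_d -> R) (K delta : R) :
  0 <= K -> 0 < delta -> (forall x, 0 <= phi x <= 1) ->
  (forall x y, `|phi x - phi y| <= K * `|x - y|) ->
  exists2 C : R, 0 <= C & forall x y,
    `|phi x - phi y| <= delta + C * (1 - cos_pi (eucl_dist x y)).
Proof.
move=> K0 d0 phi01 phiK.
pose eta := delta / (K + 1).
have K10 : 0 < K + 1 by rewrite ltr_wpDl.
have eta0 : 0 < eta by rewrite divr_gt0.
have w0 : 0 < 1 - cos_pi eta by rewrite subr_gt0 cos_pi_lt1.
exists (1 - cos_pi eta)^-1; first by rewrite invr_ge0 ltW.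
move=> x y; have [xy|xy] := leP (eucl_dist x y) eta.
  apply: (@le_trans _ _ delta); last first.
    by rewrite lerDl mulr_ge0 ?invr_ge0 ?(ltW w0)// subr_ge0 cos_pi_le1.
  apply: le_trans (phiK x y) _.
  apply: (@le_trans _ _ ((K + 1) * eta)); last by rewrite mulrC divfK ?gt_eqF.
  apply: ler_pM => //; first by rewrite lerDl.
  exact: le_trans (sup_norm_le_eucl_dist x y) xy.
apply: (@le_trans _ _ 1).
  have := phi01 x; have := phi01 y => /andP[? ?] /andP[? ?].
  by rewrite ler_norml; apply/andP; split; lra.
apply: (@le_trans _ _ ((1 - cos_pi eta)^-1 * (1 - cos_pi (eucl_dist x y)))).
  rewrite mulrC ler_pdivlMr// mul1r lerD2l lerN2.
  by apply: cos_pi_nonincreasing; rewrite ltW.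
by rewrite lerDr ltW.
Qed.

End pointwise_estimate.

(** * Almost optimal couplings determine integrals of Lipschitz functions *)

Section near_optimal.
Context {R : realType} {d : nat}.
Variables (Omega : set 'rV[R]_d).
Hypothesis mOmega : measurable (Omega : set (borel_rV R d)).
Variables (nu mu : finite_borel R d) (s m : R).
Hypotheses (s0 : 0 < s) (m0 : 0 <= m).
Hypotheses (nu_mass : nu Omega = (s ^+ 2 * m)%:E) (mu_mass : mu Omega = m%:E).
Hypothesis HK_nu_mu : (HK Omega nu mu <= (`|1 - s| * Num.sqrt m)%:E)%E.

Local Notation cone2 := (borel_cone R d * borel_cone R d)%type.

(** For masses [s^2 m] and [m] the optimal [theta] is [1 / s], and the excess integral is then
    exactly the cost minus [(1 - s)^2 m]. A coupling whose cost is within [e] of this bound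
    therefore has excess at most [e]. *)
Lemma near_optimal_excess (e : R) : 0 < e ->
  exists lambda0 lambda1 gamma,
    lifted_coupling Omega nu mu lambda0 lambda1 gamma /\
    (\int[gamma]_pq (dist_excess s^-1 pq)%:E <= e%:E)%E.
Proof.
move=> e0; pose h := `|1 - s| * Num.sqrt m.
have h0 : 0 <= h by rewrite mulr_ge0 ?sqrtr_ge0.
have h2 : h ^+ 2 = (1 - s) ^+ 2 * m.
  by rewrite exprMn sqr_sqrtr// real_normK ?num_real.
have hr : h < Num.sqrt (h ^+ 2 + e).
  by rewrite -[ltLHS]ger0_norm// -sqrtr_sqr ltr_sqrt ?ltrDl// ltr_wpDl ?sqr_ge0.
have /HK_lt[l0 [l1 [g [gP]]]] :
    (HK Omega nu mu < (Num.sqrt (h ^+ 2 + e))%:E)%E.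
  by apply: le_lt_trans HK_nu_mu _; rewrite lte_fin.
rewrite sqr_sqrtr; last by rewrite addr_ge0 ?sqr_ge0 ?ltW.
move=> gr; exists l0, l1, g; split => //.
have si0 : 0 < s^-1 by rewrite invr_gt0.
have := transport_cost_excess mOmega gP si0 nu_mass mu_mass.
move: gr (transport_cost_ge0 g); case: (transport_cost g) => [c| |]//.
rewrite lte_fin h2 => gr _.
have -> : s^-1 * (s ^+ 2 * m) + s^-1^-1 * m = 2 * (s * m).
  by field; rewrite gt_eqF.
case: (\int[g]_pq _)%E => [x| |]//= [] xE; rewrite ?leNye//.
rewrite lee_fin; nra.
Qed.

Section lipschitz_test.
Variables (phi : 'rV[R]_d -> R) (K : R).
Hypotheses (K0 : 0 <= K) (phi01 : forall x, 0 <= phi x <= 1).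
Hypothesis phiK : forall x y, `|phi x - phi y| <= K * `|x - y|.

Let phi0 x : 0 <= phi x.
Proof. by have /andP[] := phi01 x. Qed.

Let cphi : continuous phi.
Proof. exact: lipschitz_continuous phiK. Qed.

Let mphi : measurable_fun setT (phi : borel_rV R d -> R).
Proof. exact: continuous_measurable_rV. Qed.

Let fin_int (rho : finite_borel R d) :
  (\int[rho]_(x in Omega) (phi x)%:E)%E \is a fin_num.
Proof.
rewrite ge0_fin_numE; last by apply: integral_ge0 => x _; rewrite lee_fin.
apply: (@le_lt_trans _ _ (\int[rho]_(x in Omega) 1%:E)%E).
  apply: ge0_le_integral => //.
  - by move=> x _; rewrite lee_fin.
  - by apply/measurable_EFinP; apply: measurable_funTS.
  - by move=> x _; rewrite lee_fin; have /andP[] := phi01 x.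
by rewrite integral_cst// mul1e ltey_eq fin_num_measure.
Qed.

Let I (rho : finite_borel R d) : R :=
  fine (\int[rho]_(x in Omega) (phi x)%:E)%E.

Let IE (rho : finite_borel R d) : (\int[rho]_(x in Omega) (phi x)%:E)%E = (I rho)%:E.
Proof. by rewrite fineK. Qed.

Lemma measurable_weighted (f : cone2 -> R) (k : R) : measurable_fun setT f ->
  measurable_fun setT (fun pq => (k * f pq)%:E).
Proof. by move=> mf; apply/measurable_EFinP; exact: measurable_funM. Qed.

(** Integrates [weighted_difference_le] in both directions, with [a] the first radius and [b] equal
    to [s] times the second. Both [a ^+ 2] and [b ^+ 2] integrate to [s ^+ 2 * m], which doubles
    [3 * delta] to [6 * delta]. *)
Lemma coupling_bounds (delta C e : R) : 0 < delta -> 0 <= C -> 0 < e ->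
  (forall x y, `|phi x - phi y| <= delta + C * (1 - cos_pi (eucl_dist x y))) ->
  `|I nu - s ^+ 2 * I mu| <=
    6 * delta * (s ^+ 2 * m) + (delta^-1 + C) * (s * e).
Proof.
move=> d0 C0 e0 phiC.
have [l0 [l1 [g [gP gle]]]] := near_optimal_excess e0.
have k0 : 0 <= delta^-1 + C by rewrite addr_ge0// invr_ge0 ltW.
have d30 : 0 <= 3 * delta by rewrite mulr_ge0// ltW.
have s20 : 0 <= s ^+ 2 by rewrite sqr_ge0.
pose r0 (pq : cone2) : R := cone_radius (pq.1 : cone R d) ^+ 2.
pose r1 (pq : cone2) : R := cone_radius (pq.2 : cone R d) ^+ 2.
pose f0 (pq : cone2) : R :=
  cone_radius (pq.1 : cone R d) ^+ 2 * phi (cone_base0 pq.1).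
pose f1 (pq : cone2) : R :=
  cone_radius (pq.2 : cone R d) ^+ 2 * phi (cone_base0 pq.2).
pose ex (pq : cone2) : R := dist_excess s^-1 pq.
have r0_ge0 pq : 0 <= r0 pq by exact: sqr_ge0.
have r1_ge0 pq : 0 <= r1 pq by exact: sqr_ge0.
have f0_ge0 pq : 0 <= f0 pq by rewrite mulr_ge0 ?sqr_ge0.
have f1_ge0 pq : 0 <= f1 pq by rewrite mulr_ge0 ?sqr_ge0.
have ex_ge0 pq : 0 <= ex pq by rewrite dist_excess_ge0// invr_gt0.
have mr0 : measurable_fun setT r0.
  by apply: measurable_funX; exact: measurable_radius_fst.
have mr1 : measurable_fun setT r1.
  by apply: measurable_funX; exact: measurable_radius_snd.
have mf0 : measurable_fun setT f0.
  exact: (measurableT_comp (measurable_radius_base mphi)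
    (@measurable_fst _ _ _ _)).
have mf1 : measurable_fun setT f1.
  exact: (measurableT_comp (measurable_radius_base mphi)
    (@measurable_snd _ _ _ _)).
have mex : measurable_fun setT ex by exact: measurable_dist_excess.
have scaled (k : R) (f : cone2 -> R) : 0 <= k -> (forall pq, 0 <= f pq) ->
    measurable_fun setT f ->
    (\int[g]_pq (k * f pq)%:E = k%:E * \int[g]_pq (f pq)%:E)%E.
  move=> kk0 ff0 mf; under eq_integral do rewrite EFinM.
  rewrite ge0_integralZl_EFin//; first by move=> pq _; rewrite lee_fin.
  exact/measurable_EFinP.
have i0 : (\int[g]_pq (f0 pq)%:E = (I nu)%:E)%E.
  by rewrite -IE -(lifted_coupling_integral_fst mOmega gP cphi phi0).
have i1 : (\int[g]_pq (f1 pq)%:E = (I mu)%:E)%E.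
  by rewrite -IE -(lifted_coupling_integral_snd mOmega gP cphi phi0).
have ir0 : (\int[g]_pq (r0 pq)%:E = (s ^+ 2 * m)%:E)%E.
  by rewrite (lifted_coupling_radius_fst mOmega gP).
have ir1 : (\int[g]_pq (r1 pq)%:E = m%:E)%E.
  by rewrite (lifted_coupling_radius_snd mOmega gP).
have [x xE] : exists x, (\int[g]_pq (ex pq)%:E = x%:E)%E.
  exists (fine (\int[g]_pq (ex pq)%:E)%E); rewrite fineK//.
  rewrite ge0_fin_numE; last by apply: integral_ge0 => pq _; rewrite lee_fin.
  exact: le_lt_trans gle (ltry _).
have xe : x <= e by rewrite -lee_fin -xE.
(* For [theta = s^-1], the expression bounding the difference in [weighted_difference_le] is [s]
   times the excess. *)
have exE pq : (cone_radius pq.1 - s * cone_radius pq.2) ^+ 2 +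
    2 * cone_radius pq.1 * (s * cone_radius pq.2) * cone_angle pq = s * ex pq.
  by rewrite /ex /dist_excess; field; rewrite gt_eqF.
have bnd pq : f0 pq <= s ^+ 2 * f1 pq + (3 * delta) * (r0 pq + s ^+ 2 * r1 pq) +
      ((delta^-1 + C) * s) * ex pq /\
    s ^+ 2 * f1 pq <= f0 pq + (3 * delta) * (r0 pq + s ^+ 2 * r1 pq) +
      ((delta^-1 + C) * s) * ex pq.
  have a0 := cone_radius_ge0 (pq.1 : cone R d).
  have b0 : 0 <= s * cone_radius (pq.2 : cone R d).
    by rewrite mulr_ge0 ?cone_radius_ge0// ltW.
  have w0 := cone_angle_ge0 pq.
  have uv := phiC (cone_base0 pq.1) (cone_base0 pq.2).
  have u01 := phi01 (cone_base0 pq.1); have v01 := phi01 (cone_base0 pq.2).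
  have vu := uv; rewrite distrC in vu.
  have H1 := weighted_difference_le a0 b0 u01 v01 w0 d0 C0 uv.
  have H2 := weighted_difference_le b0 a0 v01 u01 w0 d0 C0 vu.
  have exE' := exE pq; rewrite /f0 /f1 /r0 /r1; split.
    by move: H1; rewrite exE' exprMn; lra.
  have -> : s ^+ 2 * (cone_radius pq.2 ^+ 2 * phi (cone_base0 pq.2)) =
      (s * cone_radius pq.2) ^+ 2 * phi (cone_base0 pq.2) by ring.
  have -> : (delta^-1 + C) * s * ex pq = (delta^-1 + C) * (s * ex pq).
    by rewrite mulrA.
  apply: le_trans H2 _; rewrite -exE' le_eqVlt; apply/orP; left.
  by apply/eqP; ring.
(* Both right sides have this form, with [s ^+ 2 * f1] or [f0] as [p]. *)
have intD (p : cone2 -> R) (z : R) : (forall pq, 0 <= p pq) ->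
    measurable_fun setT p -> (\int[g]_pq (p pq)%:E = z%:E)%E ->
    (\int[g]_pq (p pq + (3 * delta) * (r0 pq + s ^+ 2 * r1 pq) +
      ((delta^-1 + C) * s) * ex pq)%:E =
    (z + (3 * delta) * (s ^+ 2 * m + s ^+ 2 * m) +
      ((delta^-1 + C) * s) * x)%:E)%E.
  move=> p0 mp pz.
  have rr0 pq : 0 <= r0 pq + s ^+ 2 * r1 pq.
    by apply: addr_ge0 => //; exact: mulr_ge0.
  have mrr : measurable_fun setT (fun pq => r0 pq + s ^+ 2 * r1 pq).
    by apply: measurable_funD => //; exact: measurable_funM.
  have irr : (\int[g]_pq (r0 pq + s ^+ 2 * r1 pq)%:E =
      (s ^+ 2 * m + s ^+ 2 * m)%:E)%E.
    under eq_integral do rewrite EFinD.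
    rewrite ge0_integralD//; last 4 first.
    - by move=> pq _; rewrite lee_fin.
    - exact/measurable_EFinP.
    - by move=> pq _; rewrite lee_fin mulr_ge0.
    - exact: measurable_weighted.
    by rewrite ir0 scaled// ir1 -EFinM -EFinD.
  have ks0 : 0 <= (delta^-1 + C) * s by rewrite mulr_ge0// ltW.
  under eq_integral do rewrite EFinD.
  rewrite ge0_integralD//; last 4 first.
  - move=> pq _; rewrite lee_fin; apply: addr_ge0 => //; exact: mulr_ge0.
  - apply/measurable_EFinP; apply: measurable_funD => //; exact: measurable_funM.
  - by move=> pq _; rewrite lee_fin mulr_ge0.
  - exact: measurable_weighted.
  rewrite [in RHS]EFinD scaled// xE -EFinM; congr (_ + _)%E.
  under eq_integral do rewrite EFinD.
  rewrite ge0_integralD//; last 4 first.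
  - by move=> pq _; rewrite lee_fin.
  - exact/measurable_EFinP.
  - by move=> pq _; rewrite lee_fin mulr_ge0.
  - exact: measurable_weighted.
  by rewrite pz scaled// irr -EFinM -EFinD.
have mrhs (p : cone2 -> R) : measurable_fun setT p ->
    measurable_fun setT (fun pq => (p pq + (3 * delta) * (r0 pq + s ^+ 2 * r1 pq) +
      ((delta^-1 + C) * s) * ex pq)%:E).
  move=> mp; apply/measurable_EFinP; apply: measurable_funD; last first.
    exact: measurable_funM.
  apply: measurable_funD => //; apply: measurable_funM => //.
  by apply: measurable_funD => //; exact: measurable_funM.
have i1' : (\int[g]_pq (s ^+ 2 * f1 pq)%:E = (s ^+ 2 * I mu)%:E)%E.
  by rewrite scaled// i1.
have ms1 : measurable_fun setT (fun pq => s ^+ 2 * f1 pq) by exact: measurable_funM.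
have s1_ge0 pq : 0 <= s ^+ 2 * f1 pq by rewrite mulr_ge0.
have kx : (delta^-1 + C) * s * x <= (delta^-1 + C) * (s * e).
  by rewrite -mulrA ler_wpM2l// ler_wpM2l// ltW.
have B1 : I nu <= s ^+ 2 * I mu + (3 * delta) * (s ^+ 2 * m + s ^+ 2 * m) +
      ((delta^-1 + C) * s) * x.
  rewrite -lee_fin -(intD _ _ s1_ge0 ms1 i1') -i0.
  apply: ge0_le_integral => //.
  - by move=> pq _; rewrite lee_fin.
  - exact/measurable_EFinP.
  - exact: (mrhs _ ms1).
  - by move=> pq _; rewrite lee_fin; have [] := bnd pq.
have B2 : s ^+ 2 * I mu <= I nu + (3 * delta) * (s ^+ 2 * m + s ^+ 2 * m) +
      ((delta^-1 + C) * s) * x.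
  rewrite -lee_fin -(intD _ _ f0_ge0 mf0 i0) -i1'.
  apply: ge0_le_integral => //.
  - by move=> pq _; rewrite lee_fin.
  - exact/measurable_EFinP.
  - exact: (mrhs _ mf0).
  - by move=> pq _; rewrite lee_fin; have [] := bnd pq.
rewrite ler_norml; apply/andP; split; lra.
Qed.

Lemma integral_lipschitz_test :
  (\int[nu]_(x in Omega) (phi x)%:E =
   (s ^+ 2)%:E * \int[mu]_(x in Omega) (phi x)%:E)%E.
Proof.
rewrite !IE -EFinM; congr EFin; apply/eqP; rewrite -subr_eq0 -normr_le0.
apply/ler_addgt0Pl => t t0; rewrite addr0.
(* Chosen so that [6 * delta * (s ^+ 2 * m)] is at most [t / 2]; the added 1 covers [m = 0]. Since
   [C] depends on [delta], the tolerance [e] is fixed only afterwards and makes the other term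
   exactly [t / 2]. *)
pose delta := t / (2 * (6 * (s ^+ 2 * m) + 1)).
have q0 : 0 <= s ^+ 2 * m by rewrite mulr_ge0 ?sqr_ge0.
have q1 : 0 < 2 * (6 * (s ^+ 2 * m) + 1) by lra.
have d0 : 0 < delta by rewrite divr_gt0.
have [C C0 phiC] := lipschitz_cos_pi_modulus K0 d0 phi01 phiK.
have k0 : 0 < delta^-1 + C by rewrite ltr_wpDr// invr_gt0.
pose e := t / (2 * ((delta^-1 + C) * s)).
have ks0 : 0 < (delta^-1 + C) * s by rewrite mulr_gt0.
have e0 : 0 < e by rewrite divr_gt0// mulr_gt0.
apply: le_trans (coupling_bounds d0 C0 e0 phiC) _.
have -> : (delta^-1 + C) * (s * e) = t / 2.
  rewrite mulrA /e; move: (_ * s) ks0 => k kgt0.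
  by field; rewrite gt_eqF.
have : delta * (2 * (6 * (s ^+ 2 * m) + 1)) = t.
  by rewrite /delta divfK// gt_eqF.
nra.
Qed.

End lipschitz_test.
End near_optimal.

(** * Equality of measures on the Borel sets *)

Section measures_on_theory.
Context {R : realType} {d : nat}.
Variables (Omega : set 'rV[R]_d).
Hypothesis mOmega : measurable (Omega : set (borel_rV R d)).
Implicit Types mu nu : finite_borel R d.

Lemma measures_on_setI mu (A : set (borel_rV R d)) :
  measures_on Omega mu -> measurable A -> mu A = mu (A `&` Omega).
Proof.
move=> muO mA; rewrite -{1}(setIT A) -(setUv Omega) setIUr.
rewrite measureU//; last 3 first.
- exact: measurableI.
- by apply: measurableI => //; exact: measurableC.
- by rewrite setIACA setICr !setI0.
rewrite -[RHS]adde0; congr (_ + _)%E; apply/eqP; rewrite -measure_le0 -muO.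
apply: le_measure; rewrite ?inE; last exact: subIsetr.
- by apply: measurableI => //; exact: measurableC.
- exact: measurableC.
Qed.

Lemma cvg_set_test (A : set 'rV[R]_d) (x : 'rV[R]_d) : A !=set0 -> closed A ->
  limn (fun n => (set_test A n x)%:E) = (\1_(~` A) x)%:E.
Proof.
move=> A0 cA; rewrite indicE; have [Ax|nAx] := pselect (A x).
  rewrite memNset//= (_ : (fun n => _) = cst 0%:E) ?lim_cst//.
  apply/funext => n; rewrite /set_test set_dist0// mulr0 min_r//.
rewrite mem_set//=; apply: lim_near_cst => //.
have D0 : 0 < set_dist A x by apply: set_dist_gt0 => //; exact: closed_openC.
near=> n; congr EFin; rewrite /set_test min_l// -ler_pdivrMr// mul1r.
near: n; exact: nbhs_infty_ger.
Unshelve. all: by end_near. Qed.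

(** Open sets are closed under intersection and generate the Borel sets, so agreement on them
    suffices. The measure of an open set is the monotone limit of integrals of the Lipschitz
    functions [set_test]. *)
Lemma measure_eq_of_lipschitz_integral mu nu :
  measures_on Omega mu -> measures_on Omega nu ->
  (forall (phi : 'rV[R]_d -> R) (K : R), 0 <= K -> (forall x, 0 <= phi x <= 1) ->
    (forall x y, `|phi x - phi y| <= K * `|x - y|) ->
    (\int[mu]_(x in Omega) (phi x)%:E = \int[nu]_(x in Omega) (phi x)%:E)%E) ->
  measure_eq mu nu.
Proof.
move=> muO nuO H.
have HO : mu Omega = nu Omega.
  have := H (fun=> 1) 0 (lexx _) (fun _ => introT andP (conj ler01 (lexx 1))).
  rewrite !integral_cst// !mul1e; apply => x y.
  by rewrite subrr normr0 mul0r.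
have eq_open (U : set 'rV[R]_d) : open U -> mu U = nu U.
  move=> oU; have mU := open_measurable_rV oU.
  rewrite (measures_on_setI muO)// (measures_on_setI nuO)//.
  (* For [U] the whole space there is no complement to measure distances from; equality of total
     masses settles this case. *)
  have [A0|/set0P A0] := eqVneq (~` U) set0.
    by rewrite -(setCK U) A0 setC0 !setTI.
  have cA : closed (~` U) by rewrite closedC.
  have lip n x y := set_test_lipschitz n x y A0.
  have mtest n : measurable_fun (Omega : set (borel_rV R d))
      (fun x : borel_rV R d => (set_test (~` U) n x)%:E).
    apply/measurable_EFinP; apply: measurable_funTS.
    by apply: continuous_measurable_rV; exact: (lipschitz_continuous (lip n)).
  have conv (rho : finite_borel R d) : (rho (U `&` Omega) =
      limn (fun n => \int[rho]_(x in Omega) (set_test (~` U) n x)%:E))%E.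
    rewrite -monotone_convergence//; last 2 first.
    - by move=> n x _; rewrite lee_fin set_test_ge0.
    - move=> x _ m n mn; rewrite lee_fin /set_test le_min ge_min lexx/=.
      by rewrite ge_min ler_wpM2r ?set_dist_ge0 ?ler_nat// orbT.
    rewrite -integral_indic//; apply: eq_integral => x _.
    by rewrite (cvg_set_test _ A0 cA) setCK.
  rewrite !conv; congr (limn _); apply/funext => n.
  by apply: (H _ n%:R) => // x; rewrite set_test_ge0// set_test_le1.
apply: (@measure_unique _ _ (borel_rV R d) (@open 'rV[R]_d) (fun=> setT)) => //.
- by move=> U V; exact: openI.
- by move=> _; exact: openT.
- by rewrite bigcup_const.
- by move=> _; rewrite ltey_eq fin_num_measure.
Qed.

Lemma is_cone_proj_measure_eq lambda mu nu : measure_eq mu nu ->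
  is_cone_proj Omega lambda mu -> is_cone_proj Omega lambda nu.
Proof.
move=> e p phi cphi; rewrite -p//; apply: eq_measure_integral => A mA _.
exact: esym (e A mA).
Qed.

(** [HK] sees its arguments only through [is_cone_proj], that is, through integrals. This allows
    endpoints known only up to [measure_eq] to be replaced inside [HK]. *)
Lemma HK_measure_eq mu0 mu1 nu0 nu1 : measure_eq mu0 nu0 -> measure_eq mu1 nu1 ->
  HK Omega mu0 mu1 = HK Omega nu0 nu1.
Proof.
move=> e0 e1.
have e0' : measure_eq nu0 mu0 by move=> A mA; rewrite e0.
have e1' : measure_eq nu1 mu1 by move=> A mA; rewrite e1.
congr ereal_inf; congr (image _ _); apply/seteqP; split => -[l0 l1] /= [? ? ? ?];
  split => //.
- exact: is_cone_proj_measure_eq e0 _.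
- exact: is_cone_proj_measure_eq e1 _.
- exact: is_cone_proj_measure_eq e0' _.
- exact: is_cone_proj_measure_eq e1' _.
Qed.

End measures_on_theory.

(** * Existence and uniqueness of the geodesic from the null measure *)

Theorem mainTheorem14 (R : realType) (d : nat) (Omega : set 'rV[R]_d)
    (convex_Omega : convex_set Omega) (compact_Omega : compact Omega)
    (mu1 : finite_borel R d) (mu1_Omega : measures_on Omega mu1) :
  geodesic_connecting Omega null_measure mu1 (hellinger_curve mu1)
  /\ forall mu : R -> finite_borel R d,
       geodesic_connecting Omega null_measure mu1 mu ->
       forall s : R, s \in `[0, 1] -> measure_eq (mu s) (hellinger_curve mu1 s).
Proof.
have mOmega : measurable (Omega : set (borel_rV R d)).
  exact: closed_measurable_rV (compact_closed _ compact_Omega).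
pose m := fine (mu1 Omega).
have m0 : 0 <= m by exact: fine_ge0.
have mE : mu1 Omega = m%:E by rewrite fineK// fin_num_measure.
have HKh (mu : finite_borel R d) (s t : R) : measures_on Omega mu ->
    s \in `[0, 1] -> t \in `[0, 1] ->
    HK Omega (hellinger_curve mu s) (hellinger_curve mu t) =
    (`|s - t| * Num.sqrt (fine (mu Omega)))%:E.
  rewrite !in_itv/= => muO /andP[s0 _] /andP[t0 _].
  exact: (@HK_scaled _ _ _ _ mOmega muO (NngNum s0) (NngNum t0)).
have i0 : 0 \in `[(0:R), 1] by rewrite in_itv/= lexx ler01.
have i1 : 1 \in `[(0:R), 1] by rewrite in_itv/= lexx ler01.
have hE (mu : finite_borel R d) s A :
  hellinger_curve mu s A = ((s ^+ 2)%:E * mu A)%E by [].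
have h0 (mu : finite_borel R d) : measure_eq (hellinger_curve mu 0) null_measure.
  by move=> A mA; rewrite hE expr0n mul0e.
have h1 (mu : finite_borel R d) : measure_eq (hellinger_curve mu 1) mu.
  by move=> A mA; rewrite hE expr1n mul1e.
have hO (mu : finite_borel R d) s : measures_on Omega mu ->
    measures_on Omega (hellinger_curve mu s).
  move=> muO; rewrite /measures_on/= hE.
  by rewrite [X in (_ * X)%E]muO mule0.
split.
  split => //; split=> [s _|s t si ti]; first exact: hO.
  by rewrite !HKh// sub0r normrN1 mul1r -EFinM.
move=> mu [[muO muG] mu0 mu1E] s si.
have HK01 : HK Omega (mu 0) (mu 1) = (Num.sqrt m)%:E.
  rewrite (@HK_measure_eq _ _ _ _ _
    (hellinger_curve mu1 0) (hellinger_curve mu1 1)).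
  - by rewrite HKh// sub0r normrN1 mul1r.
  - by move=> A mA; rewrite mu0// h0.
  - by move=> A mA; rewrite mu1E// h1.
have s01 := si; rewrite in_itv/= in s01; case/andP: s01 => s0 s1.
(* The Hellinger curve of [mu s] itself gives the distance from 0 to [mu s] as the root of its mass;
   the geodesic property gives it as [s * Num.sqrt m]. *)
have mass : mu s Omega = (s ^+ 2 * m)%:E.
  have : HK Omega (mu 0) (mu s) = (Num.sqrt (fine (mu s Omega)))%:E.
    rewrite (@HK_measure_eq _ _ _ _ _
    (hellinger_curve (mu s) 0) (hellinger_curve (mu s) 1)).
    - by rewrite HKh ?sub0r ?normrN1 ?mul1r//; exact: muO.
    - by move=> A mA; rewrite mu0// h0.
    - by move=> A mA; rewrite h1.
  rewrite muG// HK01 sub0r normrN ger0_norm// -EFinM => -[E].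
  rewrite -(fineK (fin_num_measure (mu s) _ mOmega)); congr EFin.
  by rewrite -[LHS]sqr_sqrtr ?fine_ge0// -E exprMn sqr_sqrtr.
(* The choice [theta = 1 / s] requires [s > 0]; at [s = 0] both measures are null by the endpoint
   condition. *)
move: s0; rewrite le_eqVlt => /predU1P[s0|s0].
  move=> A mA; rewrite -s0 h0// mu0//.
apply: (measure_eq_of_lipschitz_integral mOmega) => [||phi K K0 phi01 phiK].
- exact: muO.
- exact: hO.
(* The geodesic property between [s] and 1 says that [mu s] and [mu1] are as close as their masses
   permit, which is what [near_optimal_excess] exploits. *)
have HKs : (HK Omega (mu s) mu1 <= (`|1 - s| * Num.sqrt m)%:E)%E.
  rewrite (@HK_measure_eq _ _ _ _ _
    (mu s) (mu 1))//; last first.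
    by move=> A mA; rewrite mu1E.
  by rewrite muG// HK01 -EFinM distrC.
rewrite (integral_lipschitz_test mOmega s0 m0 mass mE HKs K0 phi01 phiK).
rewrite ge0_integral_mscale//.
  apply/measurable_EFinP; apply: measurable_funTS.
  by apply: continuous_measurable_rV; exact: lipschitz_continuous phiK.
by move=> x _; rewrite lee_fin; have /andP[] := phi01 x.
Qed.
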